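(* Let $\Gamma$ be a nontrivial discrete group and let $H = C^*_\pi(\Gamma)$ be a $C^*$-completion of $\Gamma$ which is strongly perfect. Then for every $\gamma \in \Gamma$ and every integer $n \geq 0$, the $\gamma$-isotypic subspace $(E_n H)_\gamma$ of the iterated equivariant join $E_n H$ contains a unitary element of $E_nH$.
   Context: All tensor products of $C^*$-algebras are minimal. A $C^*$-completion of a discrete group $\Gamma$ is a $C^*$-algebra $C^*_\pi(\Gamma)$ obtained by completing $\mathbb{C}\Gamma$ with respect to a unitary representation $\pi$ such that $\mathbb{C}\Gamma$ injects into $C^*_\pi(\Gamma)$ and $\Delta(\gamma) = \gamma\otimes\gamma$ ($\gamma\in\Gamma$) extends linearly and continuously to a comultiplication $\Delta: C^*_\pi(\Gamma) \to C^*_\pi(\Gamma)\otimes C^*_\pi(\Gamma)$; then $(C^*_\pi(\Gamma),\Delta)$ is a compact quantum group. The completion $C^*_\pi(\Gamma)$ (with $\Gamma$ nontrivial) is called strongly perfect if $\Gamma$ is perfect (equal to its commutator subgroup) and every $\gamma\in\Gamma$ lies in the same path connected component as $1$ in the unitary group of $C^*_\pi(\Gamma)$. If a compact quantum group $(H,\Delta)$ coacts on a unital $C^*$-algebra $A$ by $\delta: A\to A\otimes H$, the equivariant join is $A \circledast^{\delta} H := \{f\in C([0,1],A\otimes H): f(0)\in\delta(A),\ f(1)\in\mathbb{C}\otimes H\}$, with induced coaction $(\delta_\Delta f)(t) = (\mathrm{id}_A\otimes\Delta)(f(t))$. The iterated joins are $(E_0H,\Delta_0) := (H,\Delta)$ and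 $(E_nH,\Delta_n) := (E_{n-1}H\circledast^{\Delta_{n-1}}H, (\Delta_{n-1})_\Delta)$. For a coaction $\delta$ of $H=C^*_\pi(\Gamma)$ on $A$ and $\gamma\in\Gamma$, the $\gamma$-isotypic subspace is $A_\gamma := \{a\in A:\delta(a)=a\otimes\gamma\}$. *)

(* Defs.v *)
From HB Require Import structures.
From mathcomp Require Import all_boot all_order all_algebra.
From mathcomp Require Import all_classical all_reals all_analysis.
From mathcomp Require Import complex.

Set Implicit Arguments.
Unset Strict Implicit.
Unset Printing Implicit Defensive.

Import Order.TTheory GRing.Theory Num.Theory.
Import numFieldNormedType.Exports.

Local Open Scope classical_set_scope.
Local Open Scope complex_scope.
Local Open Scope ring_scope.

(* The inner product is linear in its first argument. *)
HB.mixin Record isHilbert (R : realType) V & CompleteNormedModule R[i] V := {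
  dot : V -> V -> R[i];
  dot_scalar : forall y, scalar (dot^~ y);
  dotC : forall x y, dot x y = Num.conj (dot y x);
  dotxx : forall x, dot x x = `|x| ^+ 2 }.

#[short(type="hilbertType")]
HB.structure Definition Hilbert (R : realType) :=
  { V of isHilbert R V & CompleteNormedModule R[i] V }.

(* Unital C*-algebras. The product is the [%g] product of a monoid and not a
   [%R] one, because Hierarchy Builder cannot join the ring structures with
   [CompleteNormedModule] (the only declared join is [numDomainType]). *)
HB.mixin Record isCstarAlg (R : realType) A
    & monoid.Monoid A & CompleteNormedModule R[i] A := {
  cone_neq0 : (1%g : A) != 0;
  cmulDl : forall a b c : A, ((a + b)%R * c = (a * c)%g + (b * c)%g)%g;
  cmulDr : forall a b c : A, (a * (b + c)%R = (a * b)%g + (a * c)%g)%g;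
  cmulZl : forall (k : R[i]) (a b : A), ((k *: a) * b = k *: (a * b)%g)%g;
  cmulZr : forall (k : R[i]) (a b : A), (a * (k *: b) = k *: (a * b)%g)%g;
  star : A -> A;
  starD : forall a b : A, star (a + b) = star a + star b;
  starZ : forall (k : R[i]) (a : A), star (k *: a) = Num.conj k *: star a;
  starM : forall a b : A, star (a * b)%g = (star b * star a)%g;
  starK : involutive star;
  normcM_le : forall a b : A, `|(a * b)%g| <= `|a| * `|b|;
  cstar_norm : forall a : A, `|(star a * a)%g| = `|a| ^+ 2 }.

#[short(type="cstarAlgType")]
HB.structure Definition CstarAlg (R : realType) :=
  { A of isCstarAlg R A & monoid.Monoid A & CompleteNormedModule R[i] A }.

Section Basics.
Variable R : realType.
Implicit Types (A B T : cstarAlgType R) (K L M : hilbertType R).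

Definition lspan (V : lmodType R[i]) (S : set V) : set V :=
  [set v | exists (n : nat) (c : 'I_n -> R[i]) (s : 'I_n -> V),
     (forall i, S (s i)) /\ v = \sum_(i < n) c i *: s i].

Definition unitary A : set A :=
  [set a : A | (star a * a)%g = 1%g /\ (a * star a)%g = 1%g].

Definition joined_in (T : topologicalType) (U : set T) (x y : T) : Prop :=
  exists p : R -> T, [/\ {within `[0, 1], continuous p}, p 0 = x, p 1 = y
    & forall t, 0 <= t <= 1 -> U (p t)].

Definition cstar_hom A B (phi : A -> B) : Prop :=
  [/\ linear phi, {morph phi : a b / (a * b)%g}, phi 1%g = 1%g,
      {morph phi : a / star a} & continuous phi].

Definition op_norm_eq K (S : K -> K) (m : R[i]) : Prop :=
  (forall x, `|S x| <= m * `|x|) /\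
  (forall m', 0 <= m' -> (forall x, `|S x| <= m' * `|x|) -> m <= m').

(* Injective *-representations of C*-algebras are automatically isometric, so
   the last clause is faithfulness; the range is then a C*-algebra of bounded
   operators on K. *)
Definition faithful_rep A K (rho : A -> K -> K) : Prop :=
  [/\ forall a, linear (rho a),
      forall x, linear (rho^~ x),
      (forall x, rho 1%g x = x) /\
      (forall a b x, rho (a * b)%g x = rho a (rho b x)),
      forall a x y, dot (rho a x) y = dot x (rho (star a) y)
    & forall a, op_norm_eq (rho a) `|a|].

(* (M, tau) is a Hilbert space tensor product of K and L. *)
Definition is_hilbert_tensor K L M (tau : K -> L -> M) : Prop :=
  [/\ forall y, linear (tau^~ y),
      forall x, linear (tau x),
      forall x x' y y', dot (tau x y) (tau x' y') = dot x x' * dot y y'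
    & dense (lspan [set tau x y | x in setT & y in setT])].

(* The minimal (spatial) tensor product: faithful representations of A on K
   and of B on L induce a faithful representation of T on the Hilbert space
   tensor product of K and L. *)
Definition is_spatial A B T (t : A -> B -> T) : Prop :=
  exists (K L M : hilbertType R) (tau : K -> L -> M)
    (rhoA : A -> K -> K) (rhoB : B -> L -> L) (rhoT : T -> M -> M),
    [/\ is_hilbert_tensor tau,
        faithful_rep rhoA, faithful_rep rhoB, faithful_rep rhoT
      & forall a b x y,
          rhoT (t a b) (tau x y) = tau (rhoA a x) (rhoB b y)].

Record min_tensor A B := MinTensor {
  min_tensor_alg :> cstarAlgType R;
  tmul : A -> B -> min_tensor_alg;
  tmul_linearl : forall b, linear (tmul^~ b);
  tmul_linearr : forall a, linear (tmul a);
  tmul11 : tmul 1%g 1%g = 1%g;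
  tmulM : forall a a' b b',
    (tmul a b * tmul a' b')%g = tmul (a * a')%g (b * b')%g;
  tmul_star : forall a b, star (tmul a b) = tmul (star a) (star b);
  tmul_dense : dense (lspan [set tmul a b | a in setT & b in setT]);
  tmul_spatial : is_spatial tmul }.

(* A choice of a model of the minimal tensor product of any two C*-algebras;
   the model is unique up to a unique isomorphism compatible with [tmul]. *)
Definition min_tensors := forall A B, min_tensor A B.

End Basics.

Arguments unitary {R} A.
Arguments joined_in R {T} U x y.

Section QuantumGroups.
Variables (R : realType) (tens : min_tensors R).
Implicit Types A B C H : cstarAlgType R.

Local Notation "a '⊗' b" := (tmul (tens _ _) a b) (at level 40).

(* Phi is phi tensor psi; by density and continuity there is at most one. *)
Definition is_tensor_hom A A' B B' (phi : A -> A') (psi : B -> B')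
    (Phi : tens A B -> tens A' B') : Prop :=
  cstar_hom Phi /\ forall a b, Phi (a ⊗ b) = phi a ⊗ psi b.

Definition is_associator A B C
    (alpha : tens A (tens B C) -> tens (tens A B) C) : Prop :=
  cstar_hom alpha /\ forall a b c, alpha (a ⊗ (b ⊗ c)) = (a ⊗ b) ⊗ c.

(* Psi is (id tensor Delta), with values in (A ⊗ H) ⊗ H. *)
Definition is_id_tensor_comult A H (Delta : H -> tens H H)
    (Psi : tens A H -> tens (tens A H) H) : Prop :=
  exists (Phi : tens A H -> tens A (tens H H))
    (alpha : tens A (tens H H) -> tens (tens A H) H),
    [/\ is_tensor_hom id Delta Phi, is_associator alpha
      & forall x, Psi x = alpha (Phi x)].

Definition is_comultiplication H (Delta : H -> tens H H) : Prop :=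
  cstar_hom Delta /\
  exists (idD Did : tens H H -> tens (tens H H) H),
    [/\ is_id_tensor_comult Delta idD, is_tensor_hom Delta id Did
      & forall x, idD (Delta x) = Did (Delta x)].

Definition unitary_rep (G : groupType) (K : hilbertType R) (pi : G -> K -> K)
    : Prop :=
  [/\ forall g, linear (pi g),
      forall x, pi 1%g x = x,
      forall g h x, pi (g * h)%g x = pi g (pi h x)
    & forall g x y, dot (pi g x) (pi g y) = dot x y].

(* H, realised on K by rho, is the norm closure of the span of pi(G), and
   u : G -> H is the canonical map. *)
Definition is_completion (G : groupType) (K : hilbertType R)
    (pi : G -> K -> K) H (rho : H -> K -> K) (u : G -> H) : Prop :=
  [/\ faithful_rep rho, forall g, rho (u g) = pi g & dense (lspan (range u))].

Definition group_algebra_injects (G : groupType) H (u : G -> H) : Prop :=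
  forall (n : nat) (g : 'I_n -> G) (c : 'I_n -> R[i]),
    injective g -> \sum_(i < n) c i *: u (g i) = 0 -> forall i, c i = 0.

Definition is_cstar_completion (G : groupType) (K : hilbertType R)
    (pi : G -> K -> K) H (rho : H -> K -> K) (u : G -> H)
    (Delta : H -> tens H H) : Prop :=
  [/\ unitary_rep pi, is_completion pi rho u, group_algebra_injects u,
      is_comultiplication Delta & forall g, Delta (u g) = u g ⊗ u g].

Definition is_subgroup (G : groupType) (S : set G) : Prop :=
  [/\ S 1%g, forall x y, S x -> S y -> S (x * y)%g
    & forall x, S x -> S x^-1%g].

Definition commutator_subgroup (G : groupType) : set G :=
  smallest (@is_subgroup G) [set [~ x, y]%g | x in setT & y in setT].

Definition perfect_group (G : groupType) : Prop :=
  @commutator_subgroup G = setT.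

Definition strongly_perfect (G : groupType) H (u : G -> H) : Prop :=
  perfect_group G /\ forall g, joined_in R (unitary H) 1%g (u g).

(* Functions on R stand for functions on [0, 1]: their values outside are
   irrelevant. *)
Definition join_set A H (delta : A -> tens A H) : set (R -> tens A H) :=
  [set f : R -> tens A H | [/\ {within `[0, 1], continuous f}, range delta (f 0)
             & exists h : H, f 1 = 1%g ⊗ h]].

(* ev identifies J, isometrically for the sup norm and with the pointwise
   operations, with the equivariant join of A and H along delta. *)
Definition is_equivariant_join A H (delta : A -> tens A H) (J : cstarAlgType R)
    (ev : J -> R -> tens A H) : Prop :=
  [/\ forall t, 0 <= t <= 1 -> cstar_hom (ev^~ t),
      forall j, join_set delta (ev j),
      forall f, join_set delta f ->
        exists j, forall t, 0 <= t <= 1 -> ev j t = f t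
    & forall j, (forall t, 0 <= t <= 1 -> `|ev j t| <= `|j|) /\
        (forall m, (forall t, 0 <= t <= 1 -> `|ev j t| <= m) -> `|j| <= m)].

(* The coaction f |-> (t |-> (id tensor Delta) (f t)). It has values in J ⊗ H,
   which is identified with an algebra of functions from [0, 1] to (A ⊗ H) ⊗ H
   by the injective *-homomorphism x |-> (t |-> evt t x), where evt t is
   (evaluation at t) tensor id. *)
Definition is_join_coaction A H (Delta : H -> tens H H) (J : cstarAlgType R)
    (ev : J -> R -> tens A H) (deltaJ : J -> tens J H) : Prop :=
  exists (Psi : tens A H -> tens (tens A H) H)
    (evt : R -> tens J H -> tens (tens A H) H),
    [/\ is_id_tensor_comult Delta Psi,
        forall t, 0 <= t <= 1 -> is_tensor_hom (ev^~ t) id (evt t),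
        forall x, (forall t, 0 <= t <= 1 -> evt t x = 0) -> x = 0
      & forall j t, 0 <= t <= 1 -> evt t (deltaJ j) = Psi (ev j t)].

(* [iterated_join Delta n delta]: the C*-algebra A with the coaction delta is
   (a copy of) the iterated join E_n H. *)
Inductive iterated_join H (Delta : H -> tens H H) :
    nat -> forall A, (A -> tens A H) -> Prop :=
| iterated_join0 : iterated_join Delta 0 Delta
| iterated_joinS n A (delta : A -> tens A H) (J : cstarAlgType R)
    (ev : J -> R -> tens A H) (deltaJ : J -> tens J H) :
    iterated_join Delta n delta ->
    is_equivariant_join delta ev ->
    is_join_coaction Delta ev deltaJ ->
    iterated_join Delta n.+1 deltaJ.

Definition isotypic A H (delta : A -> tens A H) (g : H) : set A :=
  [set a | delta a = a ⊗ g].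

End QuantumGroups.

(* Main.v *)
Require Import Defs.
From mathcomp Require Import all_boot all_order all_algebra.
From mathcomp Require Import all_classical all_reals all_analysis.
From mathcomp Require Import complex.
From mathcomp Require Import ring lra.

Set Implicit Arguments.
Unset Strict Implicit.
Unset Printing Implicit Defensive.

Import Order.TTheory GRing.Theory Num.Theory.
Import numFieldNormedType.Exports.

(** The proof is by induction on the level n of the iterated join, with a
    stronger conclusion: every group element g has an isotypic unitary a in
    E_n that is moreover joined to 1 by a path in the unitary group of E_n
    (a need not be joined to 1 by isotypic elements). At level 0 the element g
    itself works, by strong perfectness.

    Inductive step. Let p be a path of unitaries of E_n from 1 to an isotypic
    unitary a. Then f_a(t) = p(1 - t) ⊗ g goes from a ⊗ g = delta(a) to 1 ⊗ g,
    so it is a unitary of the join E_(n+1), and it is isotypic because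
    (id ⊗ Delta)(x ⊗ g) = (x ⊗ g) ⊗ g. It is not clear that f_a is joined to 1
    in the unitary group of E_(n+1), but it can be deformed to 1 on either half
    of [0, 1]: its end point 1 ⊗ g is joined to 1 inside 1 ⊗ H, so f_a is
    homotopic to a unitary equal to 1 on [1/2, 1] (deform_right_half); its
    starting point delta(a) is joined to 1 inside delta(E_n), by delta o p, so
    f_a is homotopic to a unitary equal to 1 on [0, 1/2] (deform_left_half).
    For two group elements g and h, deform f_a towards the first kind and f_b
    towards the second kind: in the end the two unitaries commute pointwise,
    so the commutator of f_a and f_b, which is isotypic for the commutator of g
    and h, is joined to 1 (isotypic_commutator). The group elements that admit
    an isotypic unitary joined to 1 form a subgroup; it contains all
    commutators, hence is everything because the group is perfect.

    The analytic input is that an algebraic unital *-homomorphism into a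
    C*-algebra of Hilbert space operators is contractive
    (star_hom_contractive). It makes the maps a |-> a ⊗ 1, b |-> 1 ⊗ b and all
    the coactions continuous, and therefore the paths above as well. *)

Local Open Scope classical_set_scope.
Local Open Scope complex_scope.
Local Open Scope ring_scope.

(** * Normed *-algebra *)

(** Linearity is here the bare predicate used in the definitions, so the usual
    consequences are derived without a bundled linear map. *)
Section LinearMaps.
Variables (k : pzRingType) (V W : lmodType k) (f : V -> W).
Hypothesis lin_f : linear f.

Lemma linear_add a b : f (a + b) = f a + f b.
Proof. by have := lin_f 1 a b; rewrite !scale1r. Qed.

Lemma linear_zero : f 0 = 0.
Proof. by apply: (addIr (f 0)); rewrite -linear_add !add0r. Qed.

Lemma linear_scale c a : f (c *: a) = c *: f a.
Proof. by have := lin_f c a 0; rewrite linear_zero !addr0. Qed.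

Lemma linear_opp a : f (- a) = - f a.
Proof. by rewrite -!scaleN1r linear_scale. Qed.

Lemma linear_sub a b : f (a - b) = f a - f b.
Proof. by rewrite linear_add linear_opp. Qed.

End LinearMaps.

Section Algebra.
Variable R : realType.
Implicit Types A B : cstarAlgType R.

Lemma cmulBl A (a b c : A) : ((a - b)%R * c = (a * c)%g - (b * c)%g)%g.
Proof. by rewrite cmulDl -scaleN1r cmulZl scaleN1r. Qed.

Lemma cmulBr A (a b c : A) : (c * (a - b)%R = (c * a)%g - (c * b)%g)%g.
Proof. by rewrite cmulDr -scaleN1r cmulZr scaleN1r. Qed.

Lemma star1 A : star (1%g : A) = 1%g.
Proof. by rewrite -[LHS]mulg1 -{2}[1%g]starK -starM mulg1 starK. Qed.

Lemma norm_one A : `|1%g : A| = 1.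
Proof.
have : `|1%g : A| * `|1%g : A| = `|1%g : A| * 1.
  by rewrite -expr2 -cstar_norm star1 mulg1 mulr1.
by apply: mulfI; rewrite normr_eq0 cone_neq0.
Qed.

Lemma norm_expg_le A (x : A) n : `|(x ^+ n)%g| <= `|x| ^+ n.
Proof.
elim: n => [|n IHn]; first by rewrite expg0 expr0 norm_one.
rewrite expgS exprS; apply: le_trans (normcM_le _ _) _.
exact: ler_wpM2l.
Qed.

Lemma sub_geometric_sum A (x : A) n :
  ((\sum_(j < n) (x ^+ j)%g)%R * (1%g - x)%R = 1%g - (x ^+ n)%g)%g.
Proof.
elim: n => [|n IHn].
  by rewrite big_ord0 expg0 subrr -[X in (X * _)%g](scale0r 0) cmulZl scale0r.
rewrite big_ord_recr /= cmulDl IHn cmulBr mulg1 expgSr.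
by rewrite addrA subrK.
Qed.

(** This rests on a b - f g = (a - f) b + f (b - g), where f stays bounded. *)
Lemma cvg_mulg A (T : Type) (F : set_system T) (f g : T -> A) (a b : A) :
  Filter F -> f x @[x --> F] --> a -> g x @[x --> F] --> b ->
  (f x * g x)%g @[x --> F] --> (a * b)%g.
Proof.
move=> FF /cvgrPdist_lt fa /cvgrPdist_lt gb; apply/cvgrPdist_lt => e e0.
pose D := 1 + `|a| + `|b| + e.
have D_gt0 : 0 < D by rewrite ltr_wpDl // !addr_ge0.
pose d := e / D.
have d_gt0 : 0 < d by rewrite divr_gt0.
have d_le1 : d <= 1.
  by rewrite ler_pdivrMr // mul1r lerDr !addr_ge0.
near=> x.
have fax : `|a - f x| < d by near: x; exact: fa.
have gbx : `|b - g x| < d by near: x; exact: gb.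
have -> : (a * b)%g - (f x * g x)%g =
    ((a - f x)%R * b)%g + (f x * (b - g x)%R)%g.
  by rewrite cmulBl cmulBr addrA subrK.
apply: le_lt_trans (ler_normD _ _) _.
have h1 : `|((a - f x)%R * b)%g| <= d * `|b|.
  apply: le_trans (normcM_le _ _) _.
  by rewrite ler_wpM2r // ltW.
have h2 : `|(f x * (b - g x)%R)%g| <= d * (1 + `|a|).
  apply: le_trans (normcM_le _ _) _.
  rewrite mulrC; apply: ler_pM => //; first exact: ltW.
  rewrite -{1}[f x](subKr a); apply: le_trans (ler_normB _ _) _.
  by rewrite addrC lerD2r (le_trans _ d_le1) // ltW.
apply: le_lt_trans (lerD h1 h2) _.
rewrite -mulrDr {1}/d mulrAC ltr_pdivrMr // ltr_pM2l //.
by rewrite /D addrC ltrDl.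
Unshelve. all: by end_near.
Qed.

Lemma continuous_mulg A (T : topologicalType) (f g : T -> A) :
  continuous f -> continuous g -> continuous (fun x => (f x * g x)%g).
Proof. by move=> cf cg x; apply: cvg_mulg; [exact: cf | exact: cg]. Qed.

Lemma complex_ge0P (z : R[i]) : 0 <= z -> exists2 r : R, 0 <= r & z = r%:C.
Proof.
by case: z => a b; rewrite lecE /= => /andP[/eqP -> ?]; exists a.
Qed.

Lemma expr_small (r e : R[i]) : 0 <= r < 1 -> 0 < e ->
  \forall n \near \oo, r ^+ n < e.
Proof.
move=> /andP[/complex_ge0P[s s0 ->]].
rewrite (_ : 1 = 1%:C) // ltcR => s1 e0.
have [d d0 de] := complex_ge0P (ltW e0).
move: e0; rewrite {}de (_ : 0 = 0%:C) // ltcR => d_gt0.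
have /cvgrPdist_lt/(_ d d_gt0) : s ^+ n @[n --> \oo] --> (0 : R).
  by apply: cvg_expr; rewrite ger0_norm.
apply: filterS => n; rewrite sub0r normrN ger0_norm ?exprn_ge0 // => sd.
by rewrite -rmorphXn ltcR.
Qed.

(** The inverse is the sum of the Neumann series. *)
Lemma left_inverse_sub1 A (x : A) : `|x| < 1 ->
  exists c : A, (c * (1%g - x)%R = 1%g)%g.
Proof.
move=> x1; pose S (n : nat) : A := \sum_(j < n) (x ^+ j)%g.
have r0 : 0 < 1 - `|x| by rewrite subr_gt0.
have tail N k : (1 - `|x|) * `|S (N + k)%N - S N| <= `|x| ^+ N - `|x| ^+ (N + k).
  elim: k => [|k IHk]; first by rewrite addn0 !subrr normr0 mulr0.
  rewrite addnS /S big_ord_recr /= -/(S _) addrAC.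
  apply: le_trans (ler_wpM2l (ltW r0) (ler_normD _ _)) _.
  rewrite mulrDr; apply: le_trans (lerD IHk (ler_wpM2l (ltW r0) (norm_expg_le _ _))) _.
  by rewrite exprS mulrBl mul1r addrA subrK.
have /cauchy_cvgP/cvg_ex[c Sc] : cauchy (S @ \oo).
  apply: cauchy_exP => e e0.
  have : \forall n \near \oo, `|x| ^+ n < (1 - `|x|) * e.
    by apply: expr_small; [rewrite normr_ge0 | rewrite mulr_gt0].
  case/filter_ex => N xN; exists (S N); exists N => // n /= /subnKC <-.
  rewrite -ball_normE /= distrC -(ltr_pM2l r0).
  apply: le_lt_trans (tail _ _) (le_lt_trans _ xN).
  by rewrite gerBl exprn_ge0.
exists c; pose P (n : nat) : A := ((S n) * (1%g - x)%R)%g.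
have Pc : P n @[n --> \oo] --> (c * (1%g - x)%R)%g.
  exact: cvg_mulg Sc (cvg_cst _).
apply: (cvg_unique (@norm_hausdorff _ A) Pc).
have -> : P = fun n => 1%g - (x ^+ n)%g.
  by apply/funext => n; rewrite /P sub_geometric_sum.
apply/cvgrPdist_lt => e e0.
have : \forall n \near \oo, `|x| ^+ n < e.
  by apply: expr_small; rewrite // normr_ge0.
apply: filterS => n; apply: le_lt_trans.
by rewrite opprB addrC subrK norm_expg_le.
Qed.

Lemma norm_vanish A (a : A) : `|a| <= 0 -> a = 0.
Proof. by rewrite normr_le0 => /eqP. Qed.

Lemma conj_ger0 (z : R[i]) : 0 <= z -> Num.conj z = z.
Proof. by move=> z0; rewrite conj_Creal // ger0_real. Qed.

Lemma norm_selfadjoint_sub (V : hilbertType R) (x y : V) :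
  dot x y = dot y x ->
  `|x - y| ^+ 2 = `|x| ^+ 2 - 2 * dot x y + `|y| ^+ 2.
Proof.
move=> xy; rewrite -!dotxx.
have subl a b z : dot (a - b) z = dot a z - dot b z :> R[i].
  exact: (linear_sub (dot_scalar z)).
have subr a b z : dot z (a - b) = dot z a - dot z b :> R[i].
  by rewrite dotC subl rmorphB /= -!dotC.
by rewrite subl !subr xy; ring.
Qed.

Definition star_hom A B (phi : A -> B) : Prop :=
  [/\ linear phi, {morph phi : a b / (a * b)%g}, phi 1%g = 1%g
    & {morph phi : a / star a}].

(** If k = phi h had norm m > |h|, then 1 - m^-2 h^2 would be invertible by the
    Neumann series, hence so would be its image 1 - m^-2 k^2. But k^2 has m^2 as
    an approximate eigenvalue: on vectors y with |k y| close to m |y| the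
    operator 1 - m^-2 k^2 is nearly 0. Quantitatively, if C bounds the norm of
    the inverse, then |k y| <= m (1 - e) |y| with e = C^-2 / 2 for every y,
    which contradicts the choice of m. *)
Lemma selfadjoint_norm_le A B (L : hilbertType R) (rho : B -> L -> L)
    (phi : A -> B) (h : A) :
  faithful_rep rho -> star_hom phi -> star h = h -> `|phi h| <= `|h|.
Proof.
move=> [rho_lin rho_linl [rho1 rhoM] rho_star rho_norm] [phi_lin phiM phi1 phi_star] sh.
apply/negPn/negP; rewrite -real_ltNge ?normr_real //.
set k := phi h; set m := `|k| => lt_hm.
have m_gt0 : 0 < m by apply: le_lt_trans lt_hm.
have m2_gt0 : 0 < m ^+ 2 by rewrite exprn_gt0.
have sk : star k = k by rewrite -phi_star sh.
pose x := (m ^- 2 *: (h * h)%g)%R : A.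
have [c cx] : exists c : A, (c * (1%g - x)%R = 1%g)%g.
  apply: left_inverse_sub1.
  rewrite /x normrZ ger0_norm ?invr_ge0 ?(ltW m2_gt0) // mulrC.
  rewrite ltr_pdivrMr // mul1r; apply: le_lt_trans (normcM_le _ _) _.
  by rewrite -expr2 ltr_pXn2r // nnegrE ?(ltW m_gt0).
(* The summand 1 makes C >= 1, whence e <= 1 below. *)
pose C := `|phi c| + 1.
have C_gt0 : 0 < C by rewrite ltr_wpDl.
have C_ge1 : 1 <= C by rewrite lerDr.
have rho_le a y : `|rho a y| <= `|a| * `|y| := (rho_norm a).1 y.
have k2 y : rho (phi (1%g - x)) y = y - m ^- 2 *: rho k (rho k y).
  rewrite (linear_sub phi_lin) phi1 /x (linear_scale phi_lin) phiM.
  by rewrite (linear_sub (rho_linl y)) (linear_scale (rho_linl y)) rho1 rhoM.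
have low y : `|y| <= C * `|y - m ^- 2 *: rho k (rho k y)|.
  rewrite -k2 (_ : `|y| = `|rho (phi c) (rho (phi (1%g - x)) y)|).
    apply: le_trans (rho_le _ _) _.
    by rewrite ler_wpM2r // lerDl.
  by rewrite -rhoM -phiM cx phi1 rho1.
pose e := C ^- 2 / 2.
have e_gt0 : 0 < e by rewrite divr_gt0 // invr_gt0 exprn_gt0.
have e_le1 : e <= 1.
  rewrite ler_pdivrMr // mul1r.
  apply: (@le_trans _ _ 1); last by rewrite ler1n.
  by rewrite invf_le1 ?exprn_gt0 // exprn_ege1.
suff bound y : `|rho k y| <= m * (1 - e) * `|y|.
  have := (rho_norm k).2 (m * (1 - e)).
  rewrite mulr_ge0 ?subr_ge0 ?(ltW m_gt0) // => /(_ isT bound).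
  rewrite -/m -[leLHS]mulr1 ler_pM2l // lerDl oppr_ge0 => /(lt_le_trans e_gt0).
  by rewrite ltxx.
have dkk : dot (m ^- 2 *: rho k (rho k y)) y = m ^- 2 * `|rho k y| ^+ 2.
  rewrite (linear_scale (dot_scalar y)) rho_star sk.
  by rewrite -dotxx.
have kk_ge0 : 0 <= m ^- 2 * `|rho k y| ^+ 2.
  by rewrite mulr_ge0 ?invr_ge0 ?exprn_ge0 // ltW.
have dkk' : dot y (m ^- 2 *: rho k (rho k y)) = m ^- 2 * `|rho k y| ^+ 2.
  by rewrite dotC dkk conj_ger0.
(* From |k^2 y| <= m |k y|. *)
have k2_le : `|m ^- 2 *: rho k (rho k y)| ^+ 2 <= m ^- 2 * `|rho k y| ^+ 2.
  rewrite normrZ exprMn ger0_norm ?invr_ge0 ?(ltW m2_gt0) //.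
  rewrite expr2 -mulrA ler_wpM2l ?invr_ge0 ?(ltW m2_gt0) //.
  rewrite mulrC ler_pdivrMr // mulrC -exprMn.
  by rewrite lerXn2r ?nnegrE ?mulr_ge0 ?(ltW m_gt0).
have : `|y| ^+ 2 <= C ^+ 2 * (`|y| ^+ 2 - m ^- 2 * `|rho k y| ^+ 2).
  apply: (@le_trans _ _ ((C * `|y - m ^- 2 *: rho k (rho k y)|) ^+ 2)).
    by rewrite lerXn2r ?nnegrE ?mulr_ge0 ?(ltW C_gt0).
  rewrite exprMn ler_wpM2l ?exprn_ge0 ?(ltW C_gt0) //.
  rewrite norm_selfadjoint_sub ?dkk ?dkk' //.
  rewrite mulrDl !mul1r opprD addrA -[leRHS]addr0 -[X in X + _]addrA.
  rewrite -!addrA !lerD2l // addrC subr_le0.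
  exact: k2_le.
rewrite mulrC -ler_pdivrMr ?exprn_gt0 // lerBrDr -lerBrDl.
move=> le1; rewrite -(@ler_pXn2r _ 2) ?nnegrE ?mulr_ge0 ?subr_ge0 ?(ltW m_gt0) //.
move: le1; rewrite mulrC ler_pdivrMr // => /le_trans -> //.
rewrite !exprMn mulrC -mulrA ler_wpM2l ?(ltW m2_gt0) //.
rewrite -[X in X - _]mul1r mulrC -mulrBr mulrC ler_wpM2r ?exprn_ge0 //.
rewrite (_ : C ^- 2 = e + e); last by rewrite /e -splitr.
by rewrite sqrrB expr1n mul1r mulr2n lerDl exprn_ge0 // ltW.
Qed.

Definition has_faithful_rep B : Prop :=
  exists (L : hilbertType R) (rho : B -> L -> L), faithful_rep rho.

(** The C*-identity reduces the claim to the self-adjoint element a^* a. *)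
Lemma star_hom_contractive A B (phi : A -> B) (a : A) :
  has_faithful_rep B -> star_hom phi -> `|phi a| <= `|a|.
Proof.
move=> [L [rho rhoF]] phiH.
have phiM : {morph phi : a b / (a * b)%g} by case: phiH.
have phi_star : {morph phi : a / star a} by case: phiH.
rewrite -(@ler_pXn2r _ 2) ?nnegrE // -!cstar_norm -phi_star -phiM.
by apply: (selfadjoint_norm_le rhoF phiH); rewrite starM starK.
Qed.

Lemma star_hom_continuous A B (phi : A -> B) :
  has_faithful_rep B -> star_hom phi -> continuous phi.
Proof.
move=> BF phiH a; apply/cvgrPdist_lt => e e0.
have : \forall a' \near a, `|a - a'| < e.
  by apply: (cvgrPdist_lt _ _).1; first exact: cvg_id.
apply: filterS => a'; apply: le_lt_trans.
have phi_lin : linear phi by case: phiH.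
rewrite -(linear_sub phi_lin).
exact: star_hom_contractive.
Qed.

Lemma star_hom_comp A B (D : cstarAlgType R) (phi : A -> B) (psi : B -> D) :
  star_hom phi -> star_hom psi -> star_hom (psi \o phi).
Proof.
move=> [l1 m1 u1 s1] [l2 m2 u2 s2]; split => /=.
- by move=> c a b /=; rewrite l1 l2.
- by move=> a b /=; rewrite m1 m2.
- by rewrite u1 u2.
- by move=> a /=; rewrite s1 s2.
Qed.

Lemma cstar_hom_star_hom A B (phi : A -> B) : cstar_hom phi -> star_hom phi.
Proof. by case. Qed.

Lemma norm_star A (a : A) : `|star a| = `|a|.
Proof.
have le_star (b : A) : `|b| <= `|star b|.
  have [->|b0] := eqVneq b 0; first by rewrite normr0.
  rewrite -(@ler_pM2r _ `|b|) ?normr_gt0 // -expr2 -cstar_norm.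
  exact: normcM_le.
apply/eqP; rewrite eq_le le_star andbT.
by have := le_star (star a); rewrite starK.
Qed.

Lemma continuous_star A (T : topologicalType) (f : T -> A) :
  continuous f -> continuous (fun x => star (f x)).
Proof.
move=> cf x; apply/cvgrPdist_lt => e e0.
have /cvgrPdist_lt/(_ e e0) := cf x.
apply: filterS => y.
by rewrite -{1}norm_star starD -[- f y]scaleN1r starZ rmorphN1 scaleN1r.
Qed.

End Algebra.

(** * Paths of unitaries *)

Lemma continuous_compose (S T U : topologicalType) (f : S -> T) (g : T -> U) :
  continuous f -> continuous g -> continuous (fun x => g (f x)).
Proof. by move=> fC gC x; exact: (cvg_comp _ _ (fC x) (gC (f x))). Qed.

Section Paths.
Variable R : realType.
Implicit Types A B : cstarAlgType R.

Lemma unitary1 A : unitary A 1%g.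
Proof. by split; rewrite star1 mulg1. Qed.

Lemma unitaryM A (a b : A) : unitary A a -> unitary A b -> unitary A (a * b)%g.
Proof.
move=> [a1 a2] [b1 b2]; split; rewrite starM.
  by rewrite mulgA -(mulgA (star b)) a1 mulg1.
by rewrite mulgA -(mulgA a) b2 mulg1.
Qed.

Lemma unitary_star A (a : A) : unitary A a -> unitary A (star a).
Proof. by move=> [a1 a2]; split; rewrite starK. Qed.

Lemma unitary_star_hom A B (phi : A -> B) (a : A) :
  star_hom phi -> unitary A a -> unitary B (phi a).
Proof.
by move=> [_ phiM phi1 phi_star] [a1 a2]; split; rewrite -phi_star -phiM ?a1 ?a2.
Qed.

(** Paths are defined on the whole line and constant outside [0, 1], so that
    translating and rescaling the parameter never leaves the domain. *)
Definition unitary_path A (a : A) (p : R -> A) : Prop :=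
  [/\ continuous p, forall t, unitary A (p t),
      forall t, t <= 0 -> p t = 1%g & forall t, 1 <= t -> p t = a].

Definition connected_to_one A (a : A) : Prop := exists p, unitary_path a p.

Definition clamp01 (t : R) : R := Num.max 0 (Num.min t 1).

Lemma clamp01_continuous : continuous clamp01.
Proof.
move=> t; apply: (@continuous_max _ _ (fun=> 0) (fun t : R => Num.min t 1)).
  exact: cvg_cst.
apply: (@continuous_min _ _ id (fun=> 1)); first exact: cvg_id.
exact: cvg_cst.
Qed.

Lemma clamp01_itv t : 0 <= clamp01 t <= 1.
Proof. by rewrite le_max lexx ge_max ler01 ge_min lexx orbT. Qed.

Lemma clamp01_le0 t : t <= 0 -> clamp01 t = 0.
Proof. by move=> t0; apply/max_idPl; rewrite ge_min t0. Qed.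

Lemma clamp01_ge1 t : 1 <= t -> clamp01 t = 1.
Proof. by move=> t1; rewrite /clamp01 (min_idPr t1); exact/max_idPr. Qed.

(** Composing with the retraction of the line onto [0, 1] turns continuity on
    [0, 1] into continuity on the line. *)
Lemma joined_in_connected A (a : A) :
  joined_in R (unitary A) 1%g a -> connected_to_one a.
Proof.
move=> [p [pC p0 p1 pU]]; exists (p \o clamp01); split.
- move=> t; have /subspace_continuousP pC' := pC.
  have ct : `[0, 1]%classic (clamp01 t) by rewrite /= in_itv /= clamp01_itv.
  apply: (@cvg_comp _ _ _ clamp01 p _ _ _ _ (pC' _ ct)) => U UW.
  have := @clamp01_continuous t _ UW; rewrite /fmap /=; apply: (@filterS _ (nbhs t)) => s /=.
  by apply; rewrite /= in_itv /= clamp01_itv.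
- by move=> t; apply: pU; exact: clamp01_itv.
- by move=> t t0 /=; rewrite clamp01_le0.
- by move=> t t1 /=; rewrite clamp01_ge1.
Qed.

(** The path is run backwards, as the deformations below start at the element of
    interest and end at 1. *)
Lemma connected_to_oneI A (P : R -> A) :
  continuous P -> (forall s, unitary A (P s)) -> P 1 = 1%g ->
  connected_to_one (P 0).
Proof.
move=> PC PU P1; exists (fun t => P (1 - clamp01 t)); split => //.
- apply: continuous_compose PC => t.
  by apply: cvgB; [exact: cvg_cst | exact: clamp01_continuous].
- by move=> t t0; rewrite clamp01_le0 // subr0.
- by move=> t t1; rewrite clamp01_ge1 // subrr.
Qed.

Lemma connected_to_one1 A : connected_to_one (1%g : A).
Proof.
exists (fun=> 1%g); split => //; first by move=> t; exact: cvg_cst.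
by move=> t; exact: unitary1.
Qed.

Lemma connected_to_oneM A (a b : A) :
  connected_to_one a -> connected_to_one b -> connected_to_one (a * b)%g.
Proof.
move=> [p [pC pU p0 p1]] [q [qC qU q0 q1]].
exists (fun t => (p t * q t)%g); split.
- exact: continuous_mulg.
- by move=> t; exact: unitaryM.
- by move=> t t0; rewrite p0 // q0 // mulg1.
- by move=> t t1; rewrite p1 // q1.
Qed.

Lemma connected_to_one_star A (a : A) :
  connected_to_one a -> connected_to_one (star a).
Proof.
move=> [p [pC pU p0 p1]]; exists (fun t => star (p t)); split.
- exact: continuous_star.
- by move=> t; exact: unitary_star.
- by move=> t t0; rewrite p0 // star1.
- by move=> t t1; rewrite p1.
Qed.

Lemma connected_to_one_unitary A (a : A) : connected_to_one a -> unitary A a.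
Proof. by move=> [p [_ pU _ p1]]; rewrite -(p1 1). Qed.

End Paths.

Section Tensor.
Variables (R : realType) (tens : min_tensors R).
Implicit Types A B C H : cstarAlgType R.

Local Notation "a '⊗' b" := (tmul (tens _ _) a b) (at level 40).

Lemma tensor_faithful_rep A B : has_faithful_rep (tens A B).
Proof.
have [K [L [M [tau [rA [rB [rT [_ _ _ F _]]]]]]]] := tmul_spatial (tens A B).
by exists M, rT.
Qed.
Arguments tensor_faithful_rep : clear implicits.

Lemma star_hom_tmull A B : star_hom (fun a : A => a ⊗ (1%g : B)).
Proof.
split=> [|a b||a].
- exact: tmul_linearl.
- by rewrite tmulM mulg1.
- exact: tmul11.
- by rewrite tmul_star star1.
Qed.
Arguments star_hom_tmull : clear implicits.

Lemma star_hom_tmulr A B : star_hom (fun b : B => (1%g : A) ⊗ b).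
Proof.
split=> [|a b||a].
- exact: tmul_linearr.
- by rewrite tmulM mulg1.
- exact: tmul11.
- by rewrite tmul_star star1.
Qed.
Arguments star_hom_tmulr : clear implicits.

Lemma tmulE A B (a : A) (b : B) : a ⊗ b = ((a ⊗ 1%g) * (1%g ⊗ b))%g.
Proof. by rewrite tmulM mulg1 mul1g. Qed.

(** The norm of a spatial tensor product is never computed: continuity comes
    from the contractivity of the *-homomorphisms a |-> a ⊗ 1 and
    b |-> 1 ⊗ b. *)
Lemma continuous_tmul A B (T : topologicalType) (f : T -> A) (g : T -> B) :
  continuous f -> continuous g -> continuous (fun x => f x ⊗ g x).
Proof.
move=> fC gC; under eq_fun do rewrite tmulE.
apply: continuous_mulg.
  exact: continuous_compose fC (star_hom_continuous
    (tensor_faithful_rep A B) (star_hom_tmull A B)).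
exact: continuous_compose gC (star_hom_continuous
  (tensor_faithful_rep A B) (star_hom_tmulr A B)).
Qed.

Lemma unitary_tmul A B (a : A) (b : B) :
  unitary A a -> unitary B b -> unitary (tens A B) (a ⊗ b).
Proof.
move=> aU bU; rewrite tmulE; apply: unitaryM.
  exact: (unitary_star_hom (@star_hom_tmull A B)).
exact: (unitary_star_hom (@star_hom_tmulr A B)).
Qed.

End Tensor.

(** * Equivariant joins *)

Section Join.
Variables (R : realType) (tens : min_tensors R).
Variables (H A J : cstarAlgType R) (Delta : H -> tens H H).
Variables (delta : A -> tens A H) (ev : J -> R -> tens A H).
Hypothesis evJ : is_equivariant_join delta ev.

Local Notation "a '⊗' b" := (tmul (tens _ _) a b) (at level 40).

Lemma ev_star_hom t : 0 <= t <= 1 -> star_hom (ev^~ t).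
Proof. by case: evJ => evh _ _ _ /evh /cstar_hom_star_hom. Qed.

(** The norm of the join is a supremum norm over [0, 1]. *)
Lemma join_ext (i j : J) :
  (forall t, 0 <= t <= 1 -> ev i t = ev j t) -> i = j.
Proof.
move=> eq_ij; apply/eqP; rewrite -subr_eq0; apply/eqP; apply: norm_vanish.
case: evJ => _ _ _ /(_ (i - j))[_ -> //] t t01.
have [ev_lin _ _ _] := ev_star_hom t01.
by rewrite (linear_sub ev_lin) eq_ij // subrr normr0.
Qed.

Lemma unitary_join (j : J) :
  (forall t, 0 <= t <= 1 -> unitary (tens A H) (ev j t)) -> unitary J j.
Proof.
move=> jU; split; apply: join_ext => t t01; have [j1 j2] := jU t t01;
  by have [_ evM ev1 ev_star] := ev_star_hom t01; rewrite evM ev1 ev_star.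
Qed.

(** A homotopy of functions on [0, 1], jointly continuous in both variables, is a
    path for the supremum norm: this is uniform continuity on the compact
    interval, here in its open cover form. *)
Lemma lift_path (G : R -> R -> tens A H) :
  continuous (fun z : R * R => G z.1 z.2) ->
  (forall s, range delta (G s 0)) ->
  (forall s, exists h : H, G s 1 = 1%g ⊗ h) ->
  exists P : R -> J,
    continuous P /\ forall s t, 0 <= t <= 1 -> ev (P s) t = G s t.
Proof.
move=> GC G0 G1.
have [_ _ ev_surj ev_norm] := evJ.
have /choice[P PG] : forall s, exists j, forall t, 0 <= t <= 1 -> ev j t = G s t.
  move=> s; apply: ev_surj; split; [|exact: G0|exact: G1].
  apply: continuous_subspaceT.
  have pairC : continuous (fun t : R => (s, t)).
    by move=> t; exact: (cvg_pair (cvg_cst _) cvg_id).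
  exact: continuous_compose pairC GC.
exists P; split => // s; apply/cvgrPdist_le => e e0.
have /(compact_near_coveringP _).1 cover := @segment_compact R 0 1.
have near_t (t : R) : `[0, 1]%classic t -> \forall t' \near t & s' \near s,
    `|G s t' - G s' t'| < e.
  move=> _; pose d := e / 2; have d0 : 0 < d by rewrite divr_gt0.
  have /cvgrPdist_lt/(_ d d0) := GC (s, t).
  move=> [[U V] /= [Us Vt] UV].
  exists (V, U); first by split.
  move=> [t' s'] /= [Vt' Us'].
  have h1 := UV (s', t') (conj Us' Vt').
  have h2 := UV (s, t') (conj (nbhs_singleton Us) Vt').
  rewrite [e]splitr; apply: le_lt_trans (ler_distD (G s t) _ _) _.
  by rewrite ltrD // distrC.
have := cover R (nbhs s) (fun s' t => `|G s t - G s' t| < e)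
  (nbhs_filter s) near_t.
apply: (@filterS _ (nbhs s)) => s' Gs'.
apply: (ev_norm _).2 => t t01.
have [ev_lin _ _ _] := ev_star_hom t01.
rewrite (linear_sub ev_lin) !PG //; apply: ltW; apply: Gs'.
by rewrite /= in_itv.
Qed.

Variable deltaJ : J -> tens J H.
Hypothesis Delta_coaction : is_join_coaction Delta ev deltaJ.

(** The maps evt t jointly separate the points of J ⊗ H, so each identity can be
    checked after applying them, where it follows from those of id ⊗ Delta and
    of the evaluations. *)
Lemma join_coaction_star_hom : star_hom deltaJ.
Proof.
have [Psi [evt [[Phi [alpha [[Phi_hom _] [alpha_hom _] PsiE]]] evt_hom evt_inj dJ]]] :=
  Delta_coaction.
have Psi_hom : star_hom Psi.
  rewrite (_ : Psi = alpha \o Phi); last exact/funext.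
  by apply: star_hom_comp; exact: cstar_hom_star_hom.
have ext (x y : tens J H) :
    (forall t, 0 <= t <= 1 -> evt t x = evt t y) -> x = y.
  move=> xy; apply/eqP; rewrite -subr_eq0; apply/eqP; apply: evt_inj => t t01.
  have [/cstar_hom_star_hom[evt_lin _ _ _] _] := evt_hom t t01.
  by rewrite (linear_sub evt_lin) xy // subrr.
case: Psi_hom => PsiL PsiM Psi1 Psi_star.
split=> [c i j|i j||i]; apply: ext => t t01;
  have [/cstar_hom_star_hom[evtL evtM evt1 evt_star] _] := evt_hom t t01;
  have [evL evM ev1 ev_star] := ev_star_hom t01.
- by rewrite evtL !dJ // evL PsiL.
- by rewrite evtM !dJ // evM PsiM.
- by rewrite evt1 !dJ // ev1 Psi1.
- by rewrite evt_star !dJ // ev_star Psi_star.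
Qed.

(** Under id ⊗ Delta, a(t) ⊗ g becomes (a(t) ⊗ g) ⊗ g. *)
Lemma isotypic_join (j : J) (g : H) (a : R -> A) :
  Delta g = g ⊗ g -> (forall t, 0 <= t <= 1 -> ev j t = a t ⊗ g) ->
  isotypic deltaJ g j.
Proof.
move=> Dg evj.
have [Psi [evt [[Phi [alpha [[_ PhiE] [_ alphaE] PsiE]]] evt_hom evt_inj dJ]]] :=
  Delta_coaction.
apply/eqP; rewrite -subr_eq0; apply/eqP; apply: evt_inj => t t01.
have [/cstar_hom_star_hom[evt_lin _ _ _] evtE] := evt_hom t t01.
rewrite (linear_sub evt_lin) evtE dJ // evj // PsiE PhiE Dg alphaE.
exact: subrr.
Qed.

End Join.

(** * Deformations of isotypic unitaries *)

Section Isotypic.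
Variables (R : realType) (tens : min_tensors R) (H A : cstarAlgType R).
Variables (delta : A -> tens A H).
Hypothesis delta_hom : star_hom delta.

Lemma isotypic1 : isotypic delta 1%g 1%g.
Proof. by have [_ _ d1 _] := delta_hom; rewrite /isotypic /= d1 tmul11. Qed.

Lemma isotypicM g h a b :
  isotypic delta g a -> isotypic delta h b ->
  isotypic delta (g * h)%g (a * b)%g.
Proof.
by have [_ dM _ _] := delta_hom; rewrite /isotypic /= dM => -> ->; rewrite tmulM.
Qed.

Lemma isotypic_star g a : isotypic delta g a -> isotypic delta (star g) (star a).
Proof.
by have [_ _ _ ds] := delta_hom; rewrite /isotypic /= ds => ->; rewrite tmul_star.
Qed.

End Isotypic.

Section Deformation.
Variables (R : realType) (tens : min_tensors R).
Variables (H A J : cstarAlgType R).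
Variables (delta : A -> tens A H) (ev : J -> R -> tens A H).
Hypothesis evJ : is_equivariant_join delta ev.
Hypothesis delta_hom : star_hom delta.

Local Notation "a '⊗' b" := (tmul (tens _ _) a b) (at level 40).

(** The deformations traverse a path X, whose restriction to [0, 1] is the
    unitary to be deformed, at a speed that grows from 1 to 4, one end of [0, 1]
    keeping its position on X. At speed 4 the half of [0, 1] away from that end
    runs through points of X at distance at least 2 from that position. *)
Definition speed (s : R) : R := 1 + 3 * clamp01 s.

Lemma speed_continuous : continuous (fun z : R * R => speed z.1).
Proof.
move=> z; apply: cvgD; first exact: cvg_cst.
apply: cvgM; first exact: cvg_cst.
apply: (@continuous_compose _ _ _ fst (@clamp01 R)); last exact: clamp01_continuous.
by move=> w; exact: cvg_fst.
Qed.

Lemma speed_ge1 s : 1 <= speed s.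
Proof. by rewrite /speed; have := clamp01_itv s; lra. Qed.

Lemma speed0 : speed 0 = 1.
Proof. by rewrite /speed clamp01_le0 // mulr0 addr0. Qed.

Lemma speed1 : speed 1 = 4.
Proof. by rewrite /speed clamp01_ge1 //; lra. Qed.

(** For every parameter s, the curve t |-> X (phi s t) has to satisfy the boundary
    conditions of the join, so phi may move the end points as long as X keeps
    them in delta(A) and in 1 ⊗ H respectively. *)
Lemma lift_unitary_path (X : R -> tens A H) (phi : R -> R -> R) :
  continuous X -> (forall r, unitary (tens A H) (X r)) ->
  continuous (fun z : R * R => phi z.1 z.2) ->
  (forall s, range delta (X (phi s 0))) ->
  (forall s, exists h : H, X (phi s 1) = 1%g ⊗ h) ->
  exists P : R -> J, [/\ continuous P, forall s, unitary J (P s)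
    & forall s t, 0 <= t <= 1 -> ev (P s) t = X (phi s t)].
Proof.
move=> XC XU phiC X0 X1.
have [|||P [PC PE]] := @lift_path _ _ _ _ _ _ _ evJ (fun s t => X (phi s t)) => //.
  exact: (continuous_compose phiC XC).
exists P; split => // s; apply: (unitary_join evJ) => t t01.
by rewrite PE.
Qed.

Lemma continuous_affine (c d : R) : continuous (fun r : R => c + d * r).
Proof.
move=> r; apply: cvgD; first exact: cvg_cst.
by apply: cvgM; [exact: cvg_cst | exact: cvg_id].
Qed.

Lemma continuous_path_affine (B : cstarAlgType R) (p : R -> B) (c d : R) :
  continuous p -> continuous (fun r => p (c + d * r)).
Proof.
by move=> pC; apply: continuous_compose pC; exact: continuous_affine.
Qed.

Variables (g : H) (a : A).
Hypotheses (g_conn : connected_to_one g) (a_conn : connected_to_one a).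
Hypothesis a_iso : isotypic delta g a.

(** The path X(r) = p(1 - r) ⊗ q(2 - r) is p(1 - r) ⊗ g for r <= 1, then runs
    inside 1 ⊗ H from 1 ⊗ g to 1 for 1 <= r <= 2, and stays at 1. The curve
    t |-> X(c t) belongs to the join for every c >= 1, since X(0) = delta(a)
    and X(c) is in 1 ⊗ H. *)
Lemma deform_right_half : exists (P : R -> J) (p : R -> A),
  [/\ continuous P, forall s, unitary J (P s),
      forall t, 0 <= t <= 1 -> ev (P 0) t = p t ⊗ g
    & forall t, 1 / 2 <= t <= 1 -> ev (P 1) t = 1%g].
Proof.
have [p [pC pU p0 p1]] := a_conn; have [q [qC qU q0 q1]] := g_conn.
pose X r := p (1 + -1 * r) ⊗ q (2 + -1 * r).
have [||||| P [PC PU PE]] := @lift_unitary_path X (fun s t => speed s * t).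
- by apply: continuous_tmul; exact: continuous_path_affine.
- by move=> r; exact: unitary_tmul.
- move=> z; apply: cvgM; [exact: speed_continuous | exact: cvg_snd].
- move=> s; exists a => //.
  by rewrite a_iso /X !mulr0 !addr0 p1 // q1 // ler1n.
- move=> s; exists (q (2 + -1 * speed s)); rewrite /X mulr1 p0 //.
  by have := speed_ge1 s; lra.
exists P, (fun t => p (1 + -1 * t)); split => // t t01; rewrite PE.
- by rewrite speed0 mul1r /X q1 //; lra.
- by [].
- by rewrite speed1 /X p0 ?q0 ?tmul11 //; lra.
- by lra.
Qed.

(** Here X(r) is p(1 - r) ⊗ g for r >= 0, which starts at delta(a), and
    delta(p(1 + r)) for r <= 0, which is 1 for r <= -1. The curve
    t |-> X(1 - c (1 - t)) belongs to the join for every c >= 1, since its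
    starting point X(1 - c) is in delta(A) and its end point is X(1) = 1 ⊗ g. *)
Lemma deform_left_half : exists (P : R -> J) (p : R -> A),
  [/\ continuous P, forall s, unitary J (P s),
      forall t, 0 <= t <= 1 -> ev (P 0) t = p t ⊗ g
    & forall t, 0 <= t <= 1 / 2 -> ev (P 1) t = 1%g].
Proof.
have [p [pC pU p0 p1]] := a_conn.
have gU := connected_to_one_unitary g_conn.
have [da1 da2] := unitary_star_hom delta_hom (connected_to_one_unitary a_conn).
have deltaC : continuous delta.
  exact: star_hom_continuous (tensor_faithful_rep tens A H) delta_hom.
have [_ _ delta1 _] := delta_hom.
(* The two pieces are glued by a product: on either side of 0 one of the outer
   factors equals delta a, which cancels the middle factor. *)
pose X r := (delta (p (1 + 1 * r)) * (star (delta a) * (p (1 + -1 * r) ⊗ g)))%g.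
have X_left r : r <= 0 -> X r = delta (p (1 + 1 * r)).
  by move=> r0; rewrite /X [p (1 + -1 * r)]p1 -?a_iso ?da1 ?mulg1 //; lra.
have X_right r : 0 <= r -> X r = p (1 + -1 * r) ⊗ g.
  by move=> r0; rewrite /X p1 ?mulgA ?da2 ?mul1g //; lra.
have [||||| P [PC PU PE]] :=
    @lift_unitary_path X (fun s t => 1 - speed s * (1 - t)).
- apply: continuous_mulg.
    by apply: continuous_compose deltaC; exact: continuous_path_affine.
  apply: continuous_mulg; first by move=> r; exact: cvg_cst.
  apply: continuous_tmul; first exact: continuous_path_affine.
  by move=> r; exact: cvg_cst.
- move=> r; apply: unitaryM; first exact: unitary_star_hom.
  by apply: unitaryM; [exact: unitary_star | exact: unitary_tmul].
- move=> z; apply: cvgB; first exact: cvg_cst.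
  apply: cvgM; first exact: speed_continuous.
  by apply: cvgB; [exact: cvg_cst | exact: cvg_snd].
- move=> s; rewrite X_left; first by eexists.
  by have := speed_ge1 s; lra.
- move=> s; exists g; rewrite subrr mulr0 subr0 X_right // p0 //; lra.
exists P, (fun t => p (1 + -1 * t)); split => // t t01; rewrite PE.
- by rewrite speed0 mul1r subKr X_right //; lra.
- by [].
- by rewrite speed1 X_left ?p0 //; lra.
- by lra.
Qed.

End Deformation.

Section Commutators.
Variables (R : realType) (tens : min_tensors R).
Variables (H A J : cstarAlgType R) (Delta : H -> tens H H).
Variables (delta : A -> tens A H) (ev : J -> R -> tens A H).
Variable deltaJ : J -> tens J H.
Hypothesis evJ : is_equivariant_join delta ev.
Hypothesis delta_hom : star_hom delta.
Hypothesis Delta_coaction : is_join_coaction Delta ev deltaJ.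

Local Notation "a '⊗' b" := (tmul (tens _ _) a b) (at level 40).

(** This is the group commutator when a and b are unitaries. *)
Definition star_comm (B : cstarAlgType R) (a b : B) : B :=
  (star a * (star b * (a * b)))%g.

Lemma star_comm1l (B : cstarAlgType R) (b : B) :
  unitary B b -> star_comm 1%g b = 1%g.
Proof. by move=> [b1 _]; rewrite /star_comm star1 !mul1g. Qed.

Lemma star_comm1r (B : cstarAlgType R) (b : B) :
  unitary B b -> star_comm b 1%g = 1%g.
Proof. by move=> [b1 _]; rewrite /star_comm star1 mulg1 mul1g. Qed.

(** The commutator of the two deformations is a path of unitaries of the join. At
    its end, at every t one of the two arguments is 1, so the commutator is 1. *)
Lemma isotypic_commutator (g h : H) (a b : A) :
  Delta g = g ⊗ g -> Delta h = h ⊗ h ->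
  connected_to_one g -> connected_to_one h ->
  isotypic delta g a -> isotypic delta h b ->
  connected_to_one a -> connected_to_one b ->
  exists c : J, isotypic deltaJ (star_comm g h) c /\ connected_to_one c.
Proof.
move=> Dg Dh g_conn h_conn a_iso b_iso a_conn b_conn.
have [P [p [PC PU P0 P1]]] := deform_right_half evJ g_conn a_conn a_iso.
have [Q [q [QC QU Q0 Q1]]] := deform_left_half evJ delta_hom h_conn b_conn b_iso.
have deltaJ_hom := join_coaction_star_hom evJ Delta_coaction.
have P_iso := isotypic_join Delta_coaction Dg P0.
have Q_iso := isotypic_join Delta_coaction Dh Q0.
exists (star_comm (P 0) (Q 0)); split.
  apply: isotypicM (isotypic_star deltaJ_hom P_iso) _ => //.
  apply: isotypicM (isotypic_star deltaJ_hom Q_iso) _ => //.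
  exact: isotypicM.
apply: (@connected_to_oneI _ _ (fun s => star_comm (P s) (Q s))).
- apply: continuous_mulg; first exact: continuous_star.
  apply: continuous_mulg; first exact: continuous_star.
  exact: continuous_mulg.
- move=> s; apply: unitaryM; first exact: unitary_star.
  by apply: unitaryM; [exact: unitary_star | exact: unitaryM].
apply: (join_ext evJ) => t t01.
have ev_hom := ev_star_hom evJ t01.
have [_ evM ev1 ev_star] := ev_hom.
rewrite ev1 /star_comm !evM !ev_star -/(star_comm _ _).
have [t_le|t_ge] := leP t (1 / 2).
  rewrite Q1; last by lra.
  by apply: star_comm1r; exact: (unitary_star_hom ev_hom).
rewrite P1; last by lra.
by apply: star_comm1l; exact: (unitary_star_hom ev_hom).
Qed.

End Commutators.

Theorem theorem3p6 (R : realType) (tens : min_tensors R)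
    (Gamma : groupType) (K : hilbertType R) (pi : Gamma -> K -> K)
    (H : cstarAlgType R) (rho : H -> K -> K) (u : Gamma -> H)
    (Delta : H -> tens H H)
    (Gamma_nontrivial : exists g : Gamma, g <> 1%g)
    (H_completion : is_cstar_completion pi rho u Delta)
    (H_strongly_perfect : strongly_perfect u)
    (gamma : Gamma) (n : nat) (E : cstarAlgType R) (delta : E -> tens E H)
    (E_join : iterated_join Delta n delta) :
  exists a : E, isotypic delta (u gamma) a /\ unitary E a.
Proof.
have [[_ pi1 piM _] [rhoF rhou _] _ Delta_comult Delta_u] := H_completion.
have [perfect u_joined] := H_strongly_perfect.
have u_conn g : connected_to_one (u g).
  exact: joined_in_connected.
have [uM u1] : {morph u : g h / (g * h)%g} /\ u 1%g = 1%g.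
  have [rho_lin rho_linl [rho1 rhoM] _ rho_norm] := rhoF.
  have rho_inj x y : rho x = rho y -> x = y.
    move=> xy; apply/eqP; rewrite -subr_eq0; apply/eqP; apply: norm_vanish.
    apply: (rho_norm _).2 => // v.
    by rewrite (linear_sub (rho_linl v)) xy subrr normr0 mul0r.
  split=> [g h|]; apply: rho_inj; apply/funext => v.
    by rewrite rhoM !rhou piM.
  by rewrite rhou pi1 rho1.
(* A path of unitaries from 1 to u g shows in particular that u g is unitary. *)
have uV g : u g^-1%g = star (u g).
  have [ug1 ug2] := connected_to_one_unitary (u_conn g).
  by rewrite -[LHS]mul1g -ug1 -mulgA -uM mulgV u1 mulg1.
suff [delta_hom main] : star_hom delta /\
    forall g, exists a : E, isotypic delta (u g) a /\ connected_to_one a.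
  have [a [a_iso a_conn]] := main gamma; exists a; split => //.
  exact: connected_to_one_unitary.
elim: n E delta / E_join => [|n A delta J ev deltaJ _ [delta_hom IH] evJ dJ].
  split=> [|g]; first by case: Delta_comult => /cstar_hom_star_hom.
  by exists (u g); split; [exact: Delta_u | exact: u_conn].
have dJ_hom := join_coaction_star_hom evJ dJ; split => // g.
pose S := [set g : Gamma | exists a : J,
  isotypic deltaJ (u g) a /\ connected_to_one a].
have S_subgroup : is_subgroup S.
  split=> [|x y [a [a_iso a_conn]] [b [b_iso b_conn]]|x [a [a_iso a_conn]]].
  - exists 1%g; rewrite u1; split; first exact: isotypic1.
    exact: connected_to_one1.
  - exists (a * b)%g; rewrite uM; split; first exact: isotypicM.
    exact: connected_to_oneM.
  - exists (star a); rewrite uV; split; first exact: isotypic_star.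
    exact: connected_to_one_star.
suff : @commutator_subgroup Gamma `<=` S by rewrite perfect; apply.
apply: smallest_sub => // _ [x _ [y _ <-]].
have [a [a_iso a_conn]] := IH x; have [b [b_iso b_conn]] := IH y.
have [c [c_iso c_conn]] := isotypic_commutator evJ delta_hom dJ (Delta_u x)
  (Delta_u y) (u_conn x) (u_conn y) a_iso b_iso a_conn b_conn.
exists c; split => //; move: c_iso.
by rewrite /star_comm -!uV -!uM.
Qed.
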